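(* In the reinforcement-learning network model described in the context, the expected payoff process $(H(x_n))_{n\in\mathbb{N}}$ converges almost surely.
   Context: Let $G=(\mathbb{V},E)$ be a finite graph with adjacency $i\sim j$ and (unordered) edge set $E$. Let $(a_{ij})_{i,j\in\mathbb{V}}$ be nonnegative reals with $a_{ij}=a_{ji}$ and $a_{ij}>0$ only if $i\sim j$ (affinities). Let $(p_W)_{W\subseteq\mathbb{V}}$ be nonnegative reals with $\sum_W p_W=1$; for $i\sim j$ put $p_{ij}=\sum_{W\subseteq \mathbb{V}:\, i,j\in W}p_W$, and $p_{ij}=0$ if $i\not\sim j$. Assume there exist $i,j$ with $a_{ij}p_{ij}>0$. Let $v^0_{ij}=v^0_{ji}\ge 0$ with $v^0_{ij}>0$ iff $i\sim j$. The random process: $V^0_{ij}=v^0_{ij}$, $V^n_{ij}=0$ if $i\not\sim j$, $V_i^n=\sum_j V_{ij}^n$. At each time $n$, each vertex $i$ independently chooses one neighbour $j$ with probability $V_{ij}^n/V_i^n$; independently, Nature picks a random subset $W_n\subseteq\mathbb{V}$ with $\mathbb{P}(W_n=W)=p_W$, i.i.d. in $n$; if $i,j\in W_n$, $i\sim j$ and $i,j$ choose each other, then $V^{n+1}_{ij}=V^{n+1}_{ji}=V^n_{ij}+a_{ij}$, otherwise $V^{n+1}_{ij}=V^n_{ij}$. Hence $\mathbb{P}(V_{ij}^{n+1}=V_{ij}^n+a_{ij}\mid\mathcal{F}_n)=p_{ij}(V_{ij}^n)^2/(V_i^nV_j^n)$, with $\mathcal{F}_n$ the natural filtration. Let $T_n=\sum_{i,j\in\mathbb{V}}V_{ij}^n$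 (sum over ordered pairs), $x_{ij}^n=V_{ij}^n/T_n$, $x_i^n=V_i^n/T_n$, $x_n=(x^n_{ij})_{i,j}$. For an array $x=(x_{ij})$ with $x_{ij}=x_{ji}\ge0$, let $x_i=\sum_j x_{ij}$ and $H(x)=\sum_{(i,j):\,x_{ij}>0}a_{ij}p_{ij}\frac{x_{ij}^2}{x_ix_j}$ (the expected payoff). *)

(* Defs.v *)
From HB Require Import structures.
From mathcomp Require Import all_boot all_order all_algebra.
From mathcomp Require Import all_classical all_reals all_analysis.
Set Implicit Arguments. Unset Strict Implicit. Unset Printing Implicit Defensive.
Import Order.TTheory GRing.Theory Num.Theory.
Local Open Scope ring_scope.

Section RLNet.
Variables (R : realType) (V : finType).

Definition pij (e : rel V) (p : {set V} -> R) (i j : V) : R :=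
  if e i j then \sum_(W : {set V} | (i \in W) && (j \in W)) p W else 0.

(* one time step's random outcome: the choice c i of every vertex i,
   and Nature's subset W_n *)
Definition outcome := ({ffun V -> V} * {set V})%type.

Definition rowsum (M : V -> V -> R) (i : V) : R := \sum_j M i j.

(* probability that vertex i chooses c given the current state M:
   M_ic / M_i; a vertex with no neighbours (M_i = 0) makes the dummy
   "choice" of itself, which never produces a reinforcement. *)
Definition choice_prob (M : V -> V -> R) (i c : V) : R :=
  if rowsum M i == 0 then (if c == i then 1 else 0) else M i c / rowsum M i.

Definition trans_prob (p : {set V} -> R) (M : V -> V -> R) (o : outcome) : R :=
  (\prod_i choice_prob M i (o.1 i)) * p o.2.

Definition step (e : rel V) (a : V -> V -> R) (M : V -> V -> R) (o : outcome)
  : V -> V -> R :=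
  fun i j => if [&& e i j, i \in o.2, j \in o.2, o.1 i == j & o.1 j == i]
             then M i j + a i j else M i j.

Definition state (e : rel V) (a : V -> V -> R) (v0 : V -> V -> R)
  (h : seq outcome) : V -> V -> R := foldl (step e a) v0 h.

Definition total (M : V -> V -> R) : R := \sum_i \sum_j M i j.

Definition normalize (M : V -> V -> R) : V -> V -> R :=
  fun i j => M i j / total M.

Definition payoff (e : rel V) (a : V -> V -> R) (p : {set V} -> R)
  (x : V -> V -> R) : R :=
  \sum_i \sum_(j | 0 < x i j)
     a i j * pij e p i j * (x i j ^+ 2 / (rowsum x i * rowsum x j)).

End RLNet.

Definition hist_ev (T : Type) (V : finType) (X : nat -> T -> outcome V)
  (h : seq (outcome V)) : set T :=
  [set w | [seq X k w | k <- iota 0 (size h)] = h].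

(* Main.v *)
(* The payoff is the degree-0 homogeneous function
   H(V) = sum_ij b_ij V_ij^2 / (V_i V_j) with b_ij = a_ij p_ij, so no normalization is
   needed. By Cauchy-Schwarz the expected first-order variation of H along the process is
   nonnegative. Since 1 / ((1+s)(1+t)) >= 1 - s - t, the remainder is bounded below by
   -C D_ij / (V_i V_j), where D_ij is the increment of V_ij, and this is dominated by the
   decrease of K Phi(V), Phi(V) = sum_i 1 / V_i. Hence H - K Phi is a bounded submartingale;
   it converges almost surely, and Phi converges on every path because it is nonincreasing.

   Almost sure convergence of a bounded submartingale g with values in [0, B] comes from a
   maximal inequality: with G(z) = z^2 + 2 B z, convex and increasing on [0, B], one has
   eps^2 P(|g_(m+k) - g_m| >= eps for some k <= n) <= E G(g_(m+n)) - E G(g_m). *)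
Require Import Defs.
From HB Require Import structures.
From mathcomp Require Import all_boot all_order all_algebra.
From mathcomp Require Import all_classical all_reals all_analysis.
From mathcomp Require Import ring lra.
Import Order.TTheory GRing.Theory Num.Theory numFieldTopology.Exports numFieldNormedType.Exports.
Local Open Scope ring_scope.
Local Open Scope classical_set_scope.

Set Implicit Arguments.
Unset Strict Implicit.

(** * Bounded submartingales over finitely many outcomes per step *)

Section FiniteOutcomeSubmartingale.
Context {R : realType} {O : finType} {d : measure_display} {T : measurableType d}.
Variables (P : probability T R) (X : nat -> T -> O).
Hypothesis X_meas : forall n o, measurable [set w | X n w = o].
Variable t : seq O -> O -> R.
Hypothesis t_ge0 : forall h o, 0 <= t h o.
Hypothesis t_sum1 : forall h, \sum_o t h o = 1.

(** * Histories, cylinders and total probability *)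

Definition past n w := [seq X k w | k <- iota 0 n].
Definition cylinder h := [set w | past (size h) w = h].

Hypothesis X_law : forall h o,
  P (cylinder (rcons h o)) = (P (cylinder h) * (t h o)%:E)%E.

Lemma pastS n w : past n.+1 w = rcons (past n w) (X n w).
Proof. by rewrite /past -[n.+1]addn1 iotaD map_cat cats1. Qed.

(** [past n] takes finitely many values, each on a measurable set, so an arbitrary predicate [Q] on
    histories is allowed. *)
Lemma measurable_past n (Q : set (seq O)) : measurable [set w | Q (past n w)].
Proof.
elim: n Q => [|n IHn] Q.
  have [q|nq] := pselect (Q [::]).
    by rewrite (_ : [set w | _] = setT) //; apply/seteqP; split.
  by rewrite (_ : [set w | _] = set0) //; apply/seteqP; split.
rewrite (_ : [set w | _] = \big[setU/set0]_(o <- index_enum O)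
    ([set w | X n w = o] `&` [set w | Q (rcons (past n w) o)])).
  by apply: bigsetU_measurable => o _; apply: measurableI => //;
    apply: (IHn (fun h => Q (rcons h o))).
rewrite -bigcup_seq; apply/seteqP; split => w /=.
  by rewrite pastS => Qw; exists (X n w) => //=; rewrite mem_index_enum.
by case=> o _ /= [<-]; rewrite pastS.
Qed.

Lemma measurable_cylinder h : measurable (cylinder h).
Proof. exact: (measurable_past (size h) (fun h' => h' = h)). Qed.

Definition Pr (A : set T) : R := fine (P A).

Lemma Pr_ge0 A : 0 <= Pr A.
Proof. by rewrite /Pr fine_ge0. Qed.

Lemma PrE A : measurable A -> P A = (Pr A)%:E.
Proof. by move=> mA; rewrite /Pr fineK // fin_num_measure. Qed.

Lemma le_Pr A B : measurable A -> measurable B -> A `<=` B -> Pr A <= Pr B.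
Proof.
move=> mA mB AB; rewrite -lee_fin -!PrE //; apply: le_measure => //; exact: mem_set.
Qed.

Lemma Pr_cylinder_rcons h o : Pr (cylinder (rcons h o)) = Pr (cylinder h) * t h o.
Proof.
apply: EFin_inj; rewrite EFinM -!PrE //; exact: measurable_cylinder.
Qed.

(** Total probability over the next outcome, where [F o] plays the role of a bound on the
    conditional probability of [A]. Keeping the factor [Pr (cylinder h)] avoids dividing by the mass
    of a null cylinder. *)
Lemma Pr_cylinder_le h A (F : O -> R) : measurable A ->
  (forall o, Pr (cylinder (rcons h o) `&` A) <= Pr (cylinder (rcons h o)) * F o) ->
  Pr (cylinder h `&` A) <= Pr (cylinder h) * \sum_o t h o * F o.
Proof.
move=> mA leF.
have mc o : measurable (cylinder (rcons h o) `&` A).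
  by apply: measurableI => //; exact: measurable_cylinder.
have mh : measurable (cylinder h `&` A).
  by apply: measurableI => //; exact: measurable_cylinder.
apply: (@le_trans _ _ (\sum_o Pr (cylinder (rcons h o) `&` A))); last first.
  rewrite mulr_sumr; apply: ler_sum => o _.
  by rewrite mulrA -Pr_cylinder_rcons.
rewrite -lee_fin -PrE // -sumEFin.
under eq_bigr do rewrite -PrE //.
(* The sum is recast as a finitely supported one over a set, the form needed for subadditivity. *)
have -> : (\sum_(o : O) P (cylinder (rcons h o) `&` A) =
          \sum_(o \in [set: O]) P (cylinder (rcons h o) `&` A))%E.
  rewrite (fsbigE (index_enum O)) ?index_enum_uniq //.
    by apply: eq_bigl => o; rewrite in_setT.
  by move=> o _; rewrite mem_index_enum.
apply: content_sub_fsum => //; first exact: finite_finset.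
move=> w [/= hw Aw]; exists (X (size h) w) => //; split=> //.
by rewrite /cylinder /= size_rcons pastS hw.
Qed.

(** The conditional expectation of [f] of the history [n] steps later, given the present history
    [h]. Computing it from the kernel [t] gives it a value on null cylinders as well. *)
Fixpoint iter_exp n (f : seq O -> R) (h : seq O) : R :=
  if n is n'.+1 then \sum_o t h o * iter_exp n' f (rcons h o) else f h.

Lemma iter_expD m n f h : iter_exp (m + n) f h = iter_exp m (iter_exp n f) h.
Proof. by elim: m h => //= m IHm h; apply: eq_bigr => o _; rewrite IHm. Qed.

Lemma iter_exp_lin n f1 f2 a b c h :
  iter_exp n (fun h => a * f1 h + b * f2 h + c) h =
  a * iter_exp n f1 h + b * iter_exp n f2 h + c.
Proof.
elim: n h => //= n IHn h.
rewrite -[c in RHS]mul1r -(t_sum1 h) mulr_suml !mulr_sumr -!big_split /=.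
by apply: eq_bigr => o _; rewrite IHn; ring.
Qed.

Lemma iter_exp_le n f1 f2 h : (forall h, f1 h <= f2 h) ->
  iter_exp n f1 h <= iter_exp n f2 h.
Proof.
move=> f12; elim: n h => //= n IHn h; apply: ler_sum => o _.
exact: ler_wpM2l.
Qed.

Lemma iter_exp_ge n f h : (forall h, f h <= \sum_o t h o * f (rcons h o)) ->
  f h <= iter_exp n f h.
Proof.
move=> sub; elim: n h => //= n IHn h; apply: (le_trans (sub h)).
by apply: ler_sum => o _; exact: ler_wpM2l.
Qed.

Lemma Pr_cylinder_le_iter A F m h : measurable A ->
  (forall h', size h' = (size h + m)%N ->
     Pr (cylinder h' `&` A) <= Pr (cylinder h') * F h') ->
  Pr (cylinder h `&` A) <= Pr (cylinder h) * iter_exp m F h.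
Proof.
move=> mA; elim: m h => [|m IHm] h leF; first by apply: leF; rewrite addn0.
apply: Pr_cylinder_le => // o; apply: IHm => h' sh'; apply: leF.
by rewrite sh' size_rcons addSnnS.
Qed.

(** * Maximal inequality for a submartingale with values in [[0, B]] *)

Section Bounded.
Variables (g : seq O -> R) (B : R).
Hypothesis g_ge0 : forall h, 0 <= g h.
Hypothesis g_leB : forall h, g h <= B.
Hypothesis g_sub : forall h, g h <= \sum_o t h o * g (rcons h o).

(* [z ^+ 2 + b * z] is convex, and nondecreasing on the range of [g]. *)
Lemma quadratic_submartingale b c h : (forall h, 0 <= 2 * g h + b) ->
  g h ^+ 2 + b * g h + c <=
  \sum_o t h o * (g (rcons h o) ^+ 2 + b * g (rcons h o) + c).
Proof.
move=> b_ge; set x := g h.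
have le_term o : t h o * (x ^+ 2 + b * x + c) + (2 * x + b) * (t h o * g (rcons h o))
     - (2 * x + b) * x * t h o <=
  t h o * (g (rcons h o) ^+ 2 + b * g (rcons h o) + c).
  rewrite -subr_ge0 [leRHS](_ : _ = t h o * (g (rcons h o) - x) ^+ 2); last by ring.
  by rewrite mulr_ge0 ?sqr_ge0.
apply: le_trans (ler_sum _ (fun o _ => le_term o)).
rewrite sumrB big_split /= -mulr_suml -!mulr_sumr t_sum1.
have : 0 <= (2 * x + b) * (\sum_o t h o * g (rcons h o) - x).
  by rewrite mulr_ge0 ?subr_ge0 ?b_ge ?g_sub.
lra.
Qed.

Definition energy h := g h ^+ 2 + 2 * B * g h.

Lemma B_ge0 : 0 <= B. Proof. exact: le_trans (g_ge0 [::]) (g_leB [::]). Qed.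

Lemma energy_submartingale h : energy h <= \sum_o t h o * energy (rcons h o).
Proof.
have := @quadratic_submartingale (2 * B) 0 h.
rewrite addr0; under eq_bigr do rewrite addr0; apply=> h'.
by rewrite addr_ge0 // mulr_ge0 // B_ge0.
Qed.

(** The centre [c] is deterministic, so it stays fixed when a cylinder is refined in the maximal
    inequality. *)
Definition strays N n c eps :=
  [set w | exists2 k, (k <= n)%N & eps <= `|g (past (N + k) w) - c|].

Lemma measurable_strays N n c eps : measurable (strays N n c eps).
Proof.
have -> : strays N n c eps =
    \bigcup_(k in `I_n.+1) [set w | eps <= `|g (past (N + k) w) - c|].
  by apply/seteqP; split => w /= [k]; exists k.
apply: bigcup_measurable => k _.
exact: (measurable_past _ (fun h => eps <= `|g h - c|)).
Qed.

(** Doob's argument, by induction on the horizon instead of a stopping time. The function in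
    [iter_exp] is [(g - c) ^+ 2 + 2 * B * g]; the linear term makes it nondecreasing in [g], because
    [c <= B], hence a submartingale. At a hit its present value minus [2 * B * g h] is already at
    least [eps ^+ 2]; otherwise one step is taken. *)
Lemma Pr_strays_cylinder n h c eps : 0 < eps -> 0 <= c <= B ->
  eps ^+ 2 * Pr (cylinder h `&` strays (size h) n c eps) <=
  Pr (cylinder h) *
    (iter_exp n (fun h => g h ^+ 2 + (2 * B - 2 * c) * g h + c ^+ 2) h - 2 * B * g h).
Proof.
move=> eps_gt0 /andP[c_ge0 c_leB].
have e2_gt0 : 0 < eps ^+ 2 by rewrite exprn_gt0.
set phi := (fun h => _).
have phi_ge n' h' : (g h' - c) ^+ 2 <= iter_exp n' phi h' - 2 * B * g h'.
  rewrite lerBrDr; apply: (@le_trans _ _ (phi h')); last apply: iter_exp_ge.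
    by rewrite /phi le_eqVlt; apply/orP; left; apply/eqP; ring.
  move=> h2; apply: quadratic_submartingale => h3.
  by have := g_ge0 h3; lra.
have hit_bound n' h' : eps <= `|g h' - c| ->
    eps ^+ 2 * Pr (cylinder h' `&` strays (size h') n' c eps) <=
    Pr (cylinder h') * (iter_exp n' phi h' - 2 * B * g h').
  move=> hit; apply: (@le_trans _ _ (Pr (cylinder h') * eps ^+ 2)).
    rewrite mulrC ler_wpM2r ?sqr_ge0 // le_Pr //.
    - apply: measurableI; [exact: measurable_cylinder|exact: measurable_strays].
    - exact: measurable_cylinder.
  rewrite ler_wpM2l ?Pr_ge0 //; apply: le_trans (phi_ge n' h').
  by rewrite -[leRHS]real_normK ?num_real // lerXn2r ?nnegrE ?(ltW eps_gt0).
have mS N n' : measurable (strays N n' c eps) by exact: measurable_strays.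
have mc h' : measurable (cylinder h') by exact: measurable_cylinder.
elim: n h => [|n IHn] h; have [hit|nohit] := leP eps `|g h - c|.
- exact: hit_bound.
(* At horizon 0 without a hit the event is empty, and [phi_ge] at horizon 0 shows that the bound is
   nonnegative. *)
- rewrite (_ : _ `&` _ = set0) ?/Pr ?measure0 /= ?mulr0.
    by rewrite mulr_ge0 ?fine_ge0 //; apply: le_trans (phi_ge 0%N h); exact: sqr_ge0.
  apply/seteqP; split => w // [/= hw [k]]; rewrite leqn0 => /eqP ->.
  by rewrite addn0 hw leNgt nohit.
- exact: hit_bound.
(* No hit now excludes [k = 0]: the starting time grows by one and the horizon shrinks by one. *)
- have sub : cylinder h `&` strays (size h) n.+1 c eps `<=`
      cylinder h `&` strays (size h).+1 n c eps.
    move=> w [/= hw [[|k]]]; first by rewrite addn0 hw leNgt nohit.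
    by rewrite ltnS => kn; rewrite addnS => ek; split=> //; exists k; rewrite ?addSn.
  apply: (@le_trans _ _ (eps ^+ 2 * Pr (cylinder h `&` strays (size h).+1 n c eps))).
    rewrite ler_wpM2l ?sqr_ge0 // le_Pr //; exact: measurableI.
  rewrite mulrC -ler_pdivlMr //.
  pose F o := (iter_exp n phi (rcons h o) - 2 * B * g (rcons h o)) / eps ^+ 2.
  apply: (@le_trans _ _ (Pr (cylinder h) * \sum_o t h o * F o)).
    apply: Pr_cylinder_le => // o; rewrite /F mulrA ler_pdivlMr // mulrC.
    by have := IHn (rcons h o); rewrite size_rcons.
  rewrite -[leRHS]mulrA ler_wpM2l ?Pr_ge0 // /F.
  under eq_bigr do rewrite mulrA; rewrite -mulr_suml ler_wpM2r ?invr_ge0 ?(ltW e2_gt0) //=.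
  under eq_bigr do rewrite mulrBr.
  (* The subtracted terms compare the right way because the mean of [g] after one step is at least
     [g h]. *)
  rewrite sumrB lerB //.
  under eq_bigr do rewrite mulrCA; rewrite -mulr_sumr ler_wpM2l ?g_sub //.
  by rewrite mulr_ge0 ?B_ge0.
Qed.

(** The centre is now random, but [take m] recovers it from the longer history, so each event
    concerns a single history. *)
Lemma measurable_strays_within m n eps : measurable
  [set w | exists2 k, (k <= n)%N & eps <= `|g (past (m + k) w) - g (past m w)|].
Proof.
have -> : [set w | exists2 k, (k <= n)%N & eps <= `|g (past (m + k) w) - g (past m w)|] =
  \bigcup_(k in `I_n.+1)
    [set w | eps <= `|g (past (m + k) w) - g (take m (past (m + k) w))|].
  have tk k w : take m (past (m + k) w) = past m w.
    by rewrite /past iotaD map_cat take_size_cat // size_map size_iota.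
  by apply/seteqP; split => w /= [k kn ek]; exists k => //; move: ek; rewrite /= tk.
apply: bigcup_measurable => k _.
exact: (measurable_past _ (fun h => eps <= `|g h - g (take m h)|)).
Qed.

(** On each cylinder of length [m] the centre [g (past m w)] is the constant [g h], so the
    fixed-centre bound applies. With that centre it is at most the expected increase of [energy],
    and averaging over the cylinders concludes. *)
Lemma Pr_strays m n eps : 0 < eps ->
  eps ^+ 2 * Pr [set w | exists2 k, (k <= n)%N &
                 eps <= `|g (past (m + k) w) - g (past m w)|] <=
  iter_exp (m + n) energy [::] - iter_exp m energy [::].
Proof.
move=> eps_gt0; set A := [set w | _].
have mA : measurable A by exact: measurable_strays_within.
have mc h : measurable (cylinder h) by exact: measurable_cylinder.
have e2_gt0 : 0 < eps ^+ 2 by rewrite exprn_gt0.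
(* The summand 0 gives [F] the shape expected by [iter_exp_lin]. *)
pose F h := (eps ^+ 2)^-1 * iter_exp n energy h + (- (eps ^+ 2)^-1) * energy h + 0.
have leF h : size h = (size ([::] : seq O) + m)%N ->
    Pr (cylinder h `&` A) <= Pr (cylinder h) * F h.
  rewrite /= add0n => sh.
  have -> : cylinder h `&` A = cylinder h `&` strays (size h) n (g h) eps.
    apply/seteqP; split => w [/= hw [k kn ek]]; split => //; exists k => //.
      by rewrite -{2}hw sh.
    by rewrite -sh hw.
  have -> : F h = (iter_exp n energy h - energy h) / eps ^+ 2 by rewrite /F; ring.
  rewrite mulrA ler_pdivlMr // mulrC.
  have gB : 0 <= g h <= B by rewrite g_ge0 g_leB.
  apply: (le_trans (Pr_strays_cylinder n h eps_gt0 gB)).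
  rewrite ler_wpM2l ?Pr_ge0 //.
  under [X in iter_exp _ X](_ : _ = fun h' => 1 * energy h' + (- (2 * g h)) * g h' + g h ^+ 2).
    by apply/funext => h'; rewrite /energy; ring.
  rewrite iter_exp_lin /energy.
  (* The cross term [- 2 * g h * g] has mean at most [- 2 * g h ^+ 2], which turns the bound into a
     difference of energies. *)
  have : g h * g h <= g h * iter_exp n g h by rewrite ler_wpM2l // iter_exp_ge.
  lra.
have := Pr_cylinder_le_iter mA leF.
have -> : cylinder [::] = setT by apply/seteqP; split.
rewrite setTI {2}/Pr probability_setT /= mul1r /F iter_exp_lin addr0 -iter_expD.
by rewrite mulNr -mulrBr mulrC ler_pdivlMr // mulrC.
Qed.

Lemma iter_energy_nondecreasing :
  {homo (fun m => iter_exp m energy [::]) : m n / (m <= n)%N >-> m <= n}.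
Proof.
move=> m n mn; rewrite -(subnKC mn) iter_expD; apply: iter_exp_le => h.
exact/iter_exp_ge/energy_submartingale.
Qed.

Lemma iter_energy_cvg : cvgn (fun m => iter_exp m energy [::]).
Proof.
apply: nondecreasing_is_cvgn; first exact: iter_energy_nondecreasing.
exists (B ^+ 2 + 2 * B * B) => _ [m _ <-].
have E_le h : energy h <= B ^+ 2 + 2 * B * B.
  by rewrite lerD ?lerXn2r ?nnegrE ?B_ge0 // ler_wpM2l // mulr_ge0 // B_ge0.
(* The constant bound is written with zero coefficients so that [iter_exp_lin] computes its mean. *)
apply: (@le_trans _ _ (iter_exp m (fun h => 0 * g h + 0 * g h + (B ^+ 2 + 2 * B * B)) [::])).
  by apply: iter_exp_le => h; rewrite !mul0r !add0r.
by rewrite iter_exp_lin !mul0r !add0r.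
Qed.

(** * From the maximal inequality to almost sure convergence *)

Definition strays_after m eps :=
  [set w | exists k, eps <= `|g (past (m + k) w) - g (past m w)|].

Lemma strays_afterE m eps : strays_after m eps = \bigcup_n
  [set w | exists2 k, (k <= n)%N & eps <= `|g (past (m + k) w) - g (past m w)|].
Proof.
apply/seteqP; split => w /= [k]; first by move=> ek; exists k => //; exists k.
by move=> _ [j _ ej]; exists j.
Qed.

Lemma measurable_strays_after m eps : measurable (strays_after m eps).
Proof.
by rewrite strays_afterE; apply: bigcupT_measurable => n; exact: measurable_strays_within.
Qed.

(** Continuity of [P] from below as the horizon [n] grows; the mean energies increase to their
    limit. *)
Lemma Pr_strays_after m eps : 0 < eps ->
  eps ^+ 2 * Pr (strays_after m eps) <=
  limn (fun n => iter_exp n energy [::]) - iter_exp m energy [::].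
Proof.
move=> eps_gt0; have e2_gt0 : 0 < eps ^+ 2 by rewrite exprn_gt0.
rewrite mulrC -ler_pdivlMr // -lee_fin -PrE; last exact: measurable_strays_after.
rewrite strays_afterE.
set D := fun n => [set w | _].
have cvgD : P (D n) @[n --> \oo] --> P (\bigcup_n D n).
  apply: nondecreasing_cvg_mu.
  - by move=> n; exact: measurable_strays_within.
  - by apply: bigcupT_measurable => n; exact: measurable_strays_within.
  - move=> n1 n2 n12; apply/subsetPset => w /= [k kn ek].
    by exists k => //; exact: leq_trans n12.
rewrite -(cvg_lim _ cvgD) //; apply: lime_le.
  by apply/cvg_ex; exists (P (\bigcup_n D n)).
apply: nearW => n; rewrite PrE; last exact: measurable_strays_within.
rewrite lee_fin ler_pdivlMr // mulrC; apply: le_trans (Pr_strays m n eps_gt0) _.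
by rewrite lerB // nondecreasing_cvgn_le //;
  [exact: iter_energy_nondecreasing|exact: iter_energy_cvg].
Qed.

Lemma negligible_strays eps : 0 < eps ->
  P.-negligible (\bigcap_m strays_after m eps).
Proof.
move=> eps_gt0; have e2_gt0 : 0 < eps ^+ 2 by rewrite exprn_gt0.
have mA : measurable (\bigcap_m strays_after m eps).
  by apply: bigcapT_measurable => m; exact: measurable_strays_after.
exists (\bigcap_m strays_after m eps); split => //.
apply/eqP; rewrite eq_le measure_ge0 andbT PrE // lee_fin.
set L := limn (fun n => iter_exp n energy [::]).
have PrA m : eps ^+ 2 * Pr (\bigcap_m strays_after m eps) <= L - iter_exp m energy [::].
  apply: le_trans (Pr_strays_after m eps_gt0).
  rewrite ler_wpM2l ?(ltW e2_gt0) // le_Pr //; first exact: measurable_strays_after.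
  by move=> w; apply.
rewrite -(pmulr_rle0 _ e2_gt0).
(* All mean energies lie below the right-hand side, hence so does their limit [L]. *)
suff : L <= L - eps ^+ 2 * Pr (\bigcap_m strays_after m eps) by lra.
apply: limr_le; first exact: iter_energy_cvg.
by apply: nearW => m; have := PrA m; lra.
Qed.

Theorem bounded_submartingale_cvg : {ae P, forall w, cvgn (fun n => g (past n w))}.
Proof.
have eps_gt0 k : 0 < (k.+1%:R : R)^-1 by rewrite invr_gt0 ltr0n.
(* Off the countable union of the bad events for [eps = 1 / (k + 1)], the path is Cauchy. *)
apply: negligibleS (negligible_bigcup (fun k => negligible_strays (eps_gt0 k))).
move=> w /= ncvg; apply: contrapT => nbad; apply: ncvg.
apply/cauchy_cvgP/cauchy_exP => eps eps_gt0'.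
have [k _ keps] := near_infty_natSinv_lt (PosNum eps_gt0').
have /= {}keps := keps k (leqnn k).
have [m hm] : exists m, ~ strays_after m k.+1%:R^-1 w.
  apply: contrapT => nm; apply: nbad; exists k => // m _.
  by apply: contrapT => ns; apply: nm; exists m.
exists (g (past m w)); exists m => // n /= mn.
rewrite -ball_normE /= distrC ltNge; apply/negP => le_eps; apply: hm.
by exists (n - m)%N; rewrite subnKC //; exact: le_trans (ltW keps) le_eps.
Qed.

End Bounded.
End FiniteOutcomeSubmartingale.
(** * The payoff as a compensated submartingale *)

(** With [s = beta / v] and [t = gamma / w], the product [(1 - s - t) * (1 + s) * (1 + t)] is 1
    minus a sum of nonnegative terms. *)
Lemma inv_product_lower (R : realType) (v w beta gamma : R) :
  0 < v -> 0 < w -> 0 <= beta -> 0 <= gamma ->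
  v^-1 * w^-1 * (1 - beta / v - gamma / w) <= ((v + beta) * (w + gamma))^-1.
Proof.
move=> v0 w0 b0 c0.
set s := beta / v; set t := gamma / w.
have s0 : 0 <= s by rewrite divr_ge0 // ltW.
have t0 : 0 <= t by rewrite divr_ge0 // ltW.
have -> : (v + beta) * (w + gamma) = v * w * ((1 + s) * (1 + t)).
  by rewrite /s /t; field; rewrite !gt_eqF.
rewrite -invfM (invfM (v * w)) ler_wpM2l ?invr_ge0 ?mulr_ge0 ?(ltW v0) ?(ltW w0) //.
rewrite -[leRHS]div1r ler_pdivlMr ?mulr_gt0 ?ltr_pwDl //.
have := mulr_ge0 s0 t0; have := mulr_ge0 (mulr_ge0 s0 t0) s0.
have := mulr_ge0 (mulr_ge0 s0 t0) t0; have := sqr_ge0 s; have := sqr_ge0 t.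
nra.
Qed.

(** First-order expansion of one payoff term: [u] is the edge weight, [v] and [w] its two row sums,
    and [delta], [beta], [gamma] their increments. As the reciprocal is bounded below by a linear
    function, no term quadratic in [beta] and [gamma] alone appears: every error carries a factor
    [delta]. *)
Lemma payoff_term_lower (R : realType) (A rho u v w delta beta gamma : R) :
  0 < v -> 0 < w -> 0 <= u -> u <= v -> u <= w ->
  0 <= delta <= A -> 0 <= beta <= A -> 0 <= gamma <= A ->
  v^-1 <= rho -> w^-1 <= rho ->
  u ^+ 2 / (v * w) + 2 * u * delta / (v * w)
    - u ^+ 2 / (v * w) * (beta / v + gamma / w)
    - (4 * A + 2 * A ^+ 2 * rho) * (delta * (v^-1 ^+ 2 + w^-1 ^+ 2)) <=
  (u + delta) ^+ 2 / ((v + beta) * (w + gamma)).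
Proof.
move=> v0 w0 u0 uv uw /andP[d0 dA] /andP[b0 bA] /andP[c0 cA] vr wr.
apply: le_trans (ler_wpM2l (sqr_ge0 _) (inv_product_lower v0 w0 b0 c0)).
have uV : u * v^-1 <= 1 by rewrite ler_pdivrMr // mul1r.
have uW : u * w^-1 <= 1 by rewrite ler_pdivrMr // mul1r.
have V0 : 0 <= v^-1 by rewrite invr_ge0 ltW.
have W0 : 0 <= w^-1 by rewrite invr_ge0 ltW.
rewrite !invfM; set V := v^-1 in V0 uV vr *; set W := w^-1 in W0 uW wr *.
have VW0 := mulr_ge0 V0 W0.
have dVW0 := mulr_ge0 d0 VW0.
have A0 : 0 <= A := le_trans d0 dA.
(* [h1] controls the cross term [2 * u * delta], [h2] the term [delta ^+ 2], and [h3] replaces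
   [V * W] by [V ^+ 2 + W ^+ 2]. *)
have h1 : u * (beta * V + gamma * W) <= 2 * A.
  have := ler_wpM2l b0 uV; have := ler_wpM2l c0 uW; lra.
have h2 : delta * (beta * V + gamma * W) <= 2 * A ^+ 2 * rho.
  have r0 : 0 <= rho := le_trans V0 vr.
  have hb : beta * V <= A * rho by exact: ler_pM.
  have hc : gamma * W <= A * rho by exact: ler_pM.
  have hbc : 0 <= beta * V + gamma * W by rewrite addr_ge0 ?mulr_ge0.
  have : delta * (beta * V + gamma * W) <= A * (A * rho + A * rho).
    by apply: ler_pM => //; rewrite lerD.
  lra.
have h3 : 0 <= V ^+ 2 + W ^+ 2 - V * W.
  have := sqr_ge0 (V - W); rewrite sqrrB; have := sqr_ge0 V; have := sqr_ge0 W; lra.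
have C0 : 0 <= 4 * A + 2 * A ^+ 2 * rho.
  have r0 : 0 <= rho := le_trans V0 vr.
  by rewrite addr_ge0 ?mulr_ge0 ?sqr_ge0.
have k1 := ler_wpM2l dVW0 h1.
have k2 := ler_wpM2l dVW0 h2.
have k3 := mulr_ge0 (mulr_ge0 C0 d0) h3.
have k4 := mulr_ge0 dVW0 d0.
lra.
Qed.

Section Model.
Variables (R : realType) (V : finType) (e : rel V).
Hypotheses (e_sym : symmetric e) (e_irr : irreflexive e).
Variable a : V -> V -> R.
Hypotheses (a_ge0 : forall i j, 0 <= a i j) (a_sym : forall i j, a i j = a j i).
Variable p : {set V} -> R.
Hypotheses (p_ge0 : forall W, 0 <= p W) (p_sum1 : \sum_(W : {set V}) p W = 1).
Variable v0 : V -> V -> R.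
Hypotheses (v0_sym : forall i j, v0 i j = v0 j i) (v0_ge0 : forall i j, 0 <= v0 i j).
Hypothesis v0_edge : forall i j, 0 < v0 i j <-> e i j.

(** * Invariants of the states and one-step gains *)

Definition reachable (M : V -> V -> R) :=
  [/\ forall i j, M i j = M j i, forall i j, v0 i j <= M i j
    & forall i j, ~~ e i j -> M i j = 0].

Lemma reachable_v0 : reachable v0.
Proof.
split=> // i j nij; apply/eqP; rewrite eq_le v0_ge0 andbT leNgt.
by apply: contra nij => /v0_edge.
Qed.

Definition gain (M : V -> V -> R) o i j := step e a M o i j - M i j.

Lemma gainE M o i j : gain M o i j =
  if [&& e i j, i \in o.2, j \in o.2, o.1 i == j & o.1 j == i] then a i j else 0.
Proof. by rewrite /gain /step; case: ifP => _; rewrite ?addrK ?subrr // addrC addKr. Qed.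

Lemma stepE M o i j : step e a M o i j = M i j + gain M o i j.
Proof. by rewrite /gain addrC subrK. Qed.

Lemma gain_ge0 M o i j : 0 <= gain M o i j.
Proof. by rewrite gainE; case: ifP. Qed.

Lemma gain_le M o i j : gain M o i j <= a i j.
Proof. by rewrite gainE; case: ifP. Qed.

Lemma gain_sym M o i j : gain M o i j = gain M o j i.
Proof.
rewrite !gainE e_sym a_sym; congr (if _ then _ else _).
by case: (e j i); case: (i \in _); case: (j \in _) => //=; rewrite andbC.
Qed.

Lemma gain_nonedge M o i j : ~~ e i j -> gain M o i j = 0.
Proof. by rewrite gainE => /negbTE ->. Qed.

Lemma reachable_step M o : reachable M -> reachable (step e a M o).
Proof.
move=> [Ms Mv M0]; split=> [i j|i j|i j nij]; rewrite stepE.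
- by rewrite stepE Ms gain_sym.
- by rewrite ler_wpDr // gain_ge0.
- by rewrite M0 // gain_nonedge // addr0.
Qed.

Lemma state_rcons h o : state e a v0 (rcons h o) = step e a (state e a v0 h) o.
Proof. by rewrite /state foldl_rcons. Qed.

Lemma reachable_state h : reachable (state e a v0 h).
Proof.
elim/last_ind: h => [|h o IHh]; first exact: reachable_v0.
by rewrite state_rcons; exact: reachable_step.
Qed.

Section Reachable.
Variable M : V -> V -> R.
Hypothesis M_reach : reachable M.

Lemma reach_ge0 i j : 0 <= M i j.
Proof. by case: M_reach => _ Mv _; exact: le_trans (Mv i j). Qed.

Lemma reach_edge i j : e i j -> 0 < M i j.
Proof. by case: M_reach => _ Mv _ /v0_edge; move=> /lt_le_trans; apply. Qed.

Lemma rowsum_ge0 i : 0 <= rowsum M i.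
Proof. by apply: sumr_ge0 => j _; exact: reach_ge0. Qed.

Lemma reach_le_rowsum i j : M i j <= rowsum M i.
Proof.
by rewrite /rowsum (bigD1 j) //= lerDl sumr_ge0 // => k _; exact: reach_ge0.
Qed.

Lemma rowsum_gt0 i j : e i j -> 0 < rowsum M i.
Proof. by move=> /reach_edge /lt_le_trans; apply; exact: reach_le_rowsum. Qed.

Lemma rowsum_v0_le i : rowsum v0 i <= rowsum M i.
Proof. by case: M_reach => _ Mv _; apply: ler_sum => j _. Qed.

Lemma rowsum_v0_gt0 i : 0 < rowsum M i -> 0 < rowsum v0 i.
Proof.
move=> Mi; rewrite lt_neqAle eq_sym sumr_ge0 ?andbT //.
apply: contraTneq Mi => v0i; rewrite -leNgt; apply: sumr_le0 => j _.
case: M_reach => _ _ M0; rewrite M0 //; apply/negP => /v0_edge.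
have /eqP := v0i; rewrite /rowsum psumr_eq0 // => /allP /(_ j).
by rewrite mem_index_enum => /(_ isT) /eqP ->; rewrite ltxx.
Qed.

(** * The one-step law and the expected gains *)

Lemma choice_prob_ge0 i c : 0 <= choice_prob M i c.
Proof.
rewrite /choice_prob; case: ifP => _; first by case: ifP.
by rewrite divr_ge0 ?rowsum_ge0 ?reach_ge0.
Qed.

Lemma choice_prob_sum1 i : \sum_c choice_prob M i c = 1.
Proof.
rewrite /choice_prob; have [_|ri] := eqVneq (rowsum M i) 0.
  by rewrite -big_mkcond big_pred1_eq.
by rewrite -mulr_suml divff.
Qed.

Lemma trans_prob_ge0 o : 0 <= trans_prob p M o.
Proof. by rewrite mulr_ge0 ?prodr_ge0 // => i _; exact: choice_prob_ge0. Qed.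

(** Independence of the vertices' choices from Nature's subset. *)
Lemma trans_prob_sumM (f : {ffun V -> V} -> R) (k : {set V} -> R) :
  \sum_(o : outcome V) trans_prob p M o * (f o.1 * k o.2) =
  (\sum_(c : {ffun V -> V}) (\prod_i choice_prob M i (c i)) * f c) * \sum_W p W * k W.
Proof.
rewrite mulr_suml; under [RHS]eq_bigr do rewrite mulr_sumr.
rewrite pair_bigA /=; apply: eq_bigr => -[c W] _; rewrite /trans_prob /=; ring.
Qed.

Lemma trans_prob_sum1 : \sum_(o : outcome V) trans_prob p M o = 1.
Proof.
have := trans_prob_sumM (fun=> 1) (fun=> 1).
under eq_bigr do rewrite !mulr1.
under [X in _ = X * _]eq_bigr do rewrite mulr1.
under [X in _ = _ * X]eq_bigr do rewrite mulr1.
rewrite p_sum1 mulr1 => ->.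
rewrite -(bigA_distr_bigA (fun i c => choice_prob M i c)) /=.
by rewrite big1 // => i _; exact: choice_prob_sum1.
Qed.

(** The indicator of a mutual choice is a product over vertices of factors [ind k (c k)]. Exchanging
    sum and product leaves a factor 1 at each vertex other than [i] and [j]. *)
Lemma mutual_choice_prob i j : i != j ->
  \sum_(c : {ffun V -> V}) (\prod_k choice_prob M k (c k)) *
     ((c i == j) && (c j == i))%:R =
  choice_prob M i j * choice_prob M j i.
Proof.
move=> ij; pose ind k c : R :=
  if k == i then (c == j)%:R else if k == j then (c == i)%:R else 1.
have prodE (F : V -> R) : \prod_k F k = F i * (F j * \prod_(k | (k != i) && (k != j)) F k).
  by rewrite (bigD1 i) // (bigD1 j) 1?eq_sym.
transitivity (\sum_(c : {ffun V -> V}) \prod_k (choice_prob M k (c k) * ind k (c k))).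
  apply: eq_bigr => c _; rewrite big_split /=; congr (_ * _).
  rewrite prodE big1 => [|k /andP[/negbTE ki /negbTE kj]]; last by rewrite /ind ki kj.
  by rewrite /ind !eqxx (eq_sym j) (negbTE ij) mulr1 -natrM mulnb.
rewrite -(bigA_distr_bigA (fun k c => choice_prob M k c * ind k c)) /=.
have pick k x : \sum_c choice_prob M k c * (c == x)%:R = choice_prob M k x.
  rewrite (bigD1 x) //= eqxx mulr1 big1 ?addr0 // => c /negbTE ->.
  by rewrite mulr0.
rewrite prodE [X in _ * (_ * X)]big1 => [|k /andP[/negbTE ki /negbTE kj]].
  rewrite /ind eqxx pick mulr1 (eq_sym j) (negbTE ij).
  by under eq_bigr do rewrite eqxx; rewrite pick.
rewrite -(choice_prob_sum1 k); apply: eq_bigr => c _.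
by rewrite /ind ki kj mulr1.
Qed.

(** This has two roles: the expected increment of an entry, and the corresponding term of the payoff
    at the unnormalized state. *)
Definition mean_gain i j :=
  a i j * pij e p i j * (M i j ^+ 2 / (rowsum M i * rowsum M j)).

Lemma expected_gain i j :
  \sum_(o : outcome V) trans_prob p M o * gain M o i j = mean_gain i j.
Proof.
rewrite /mean_gain /pij; have [eij|neij] := ifPn; last first.
  by rewrite mulr0 mul0r big1 // => o _; rewrite gain_nonedge // mulr0.
have ij : i != j by apply: contraTneq eij => ->; rewrite e_irr.
have ri := rowsum_gt0 eij.
have rj : 0 < rowsum M j by apply: (@rowsum_gt0 j i); rewrite e_sym.
have := trans_prob_sumM (fun c => ((c i == j) && (c j == i))%:R)
  (fun W => ((i \in W) && (j \in W))%:R).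
rewrite mutual_choice_prob // /choice_prob !gt_eqF //.
have -> : \sum_(W : {set V}) p W * ((i \in W) && (j \in W))%:R =
    \sum_(W : {set V} | (i \in W) && (j \in W)) p W.
  by rewrite [RHS]big_mkcond; apply: eq_bigr => W _; case: ifP; rewrite ?mulr1 ?mulr0.
case: M_reach => /(_ j i) -> _ _ E.
transitivity (a i j * (M i j / rowsum M i * (M i j / rowsum M j) *
    \sum_(W : {set V} | (i \in W) && (j \in W)) p W)).
  rewrite -E mulr_sumr; apply: eq_bigr => o _; rewrite gainE eij /=.
  case: (i \in o.2); case: (j \in o.2); case: (o.1 i == j); case: (o.1 j == i);
    rewrite /= ?mulr1 ?mulr0 // mulrC //.
by rewrite invfM; ring.
Qed.

(** * Uniform constants and bounds *)

Definition affinity_sum := \sum_i \sum_j a i j.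
(* Isolated vertices contribute [0^-1 = 0]. *)
Definition inv_rowsum_sum (N : V -> V -> R) := \sum_i (rowsum N i)^-1.
(** The error constant of [payoff_term_lower] with [A = affinity_sum] and
    [rho = inv_rowsum_sum v0]. *)
Definition remainder_const :=
  4 * affinity_sum + 2 * affinity_sum ^+ 2 * inv_rowsum_sum v0.
(** The factor 2 counts the two endpoints of an edge, [affinity_sum] bounds the weight
    [a i j * pij e p i j], and the last factor comes from [inv_rowsum_drop]. *)
Definition penalty := 2 * affinity_sum * remainder_const * (1 + affinity_sum * inv_rowsum_sum v0).

Lemma row_affinity_le i : \sum_j a i j <= affinity_sum.
Proof.
rewrite /affinity_sum [leRHS](bigD1 i) //= lerDl.
by apply: sumr_ge0 => k _; apply: sumr_ge0.
Qed.

Lemma affinity_le i j : a i j <= affinity_sum.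
Proof.
apply: le_trans (row_affinity_le i).
by rewrite [leRHS](bigD1 j) //= lerDl; apply: sumr_ge0.
Qed.

Lemma affinity_sum_ge0 : 0 <= affinity_sum.
Proof. by apply: sumr_ge0 => i _; apply: sumr_ge0. Qed.

Lemma rowsum_v0_ge0 i : 0 <= rowsum v0 i.
Proof. exact: sumr_ge0. Qed.

Lemma inv_rowsum_v0_ge0 : 0 <= inv_rowsum_sum v0.
Proof. by apply: sumr_ge0 => i _; rewrite invr_ge0 rowsum_v0_ge0. Qed.

Lemma remainder_const_ge0 : 0 <= remainder_const.
Proof.
by rewrite addr_ge0 ?mulr_ge0 ?sqr_ge0 ?affinity_sum_ge0 ?inv_rowsum_v0_ge0.
Qed.

Lemma penalty_ge0 : 0 <= penalty.
Proof.
by rewrite !mulr_ge0 ?remainder_const_ge0 ?addr_ge0 ?mulr_ge0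
  ?affinity_sum_ge0 ?inv_rowsum_v0_ge0.
Qed.

Lemma inv_rowsum_le i : (rowsum M i)^-1 <= (rowsum v0 i)^-1.
Proof.
have := rowsum_ge0 i; rewrite le_eqVlt => /orP[/eqP <-|Mi].
  by rewrite invr0 invr_ge0 rowsum_v0_ge0.
by rewrite lef_pV2 ?posrE ?rowsum_v0_gt0 // rowsum_v0_le.
Qed.

Lemma inv_rowsum_le_sum i : (rowsum M i)^-1 <= inv_rowsum_sum v0.
Proof.
apply: (le_trans (inv_rowsum_le i)); rewrite /inv_rowsum_sum (bigD1 i) //= lerDl.
by apply: sumr_ge0 => k _; rewrite invr_ge0 rowsum_v0_ge0.
Qed.

Lemma pij_ge0 i j : 0 <= pij e p i j.
Proof. by rewrite /pij; case: ifP => // _; apply: sumr_ge0. Qed.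

Lemma pij_le1 i j : pij e p i j <= 1.
Proof.
rewrite /pij; case: ifP => // _; rewrite -p_sum1.
rewrite [leRHS](bigID (fun W : {set V} => (i \in W) && (j \in W))) /= lerDl.
exact: sumr_ge0.
Qed.

Lemma weight_ge0 i j : 0 <= a i j * pij e p i j.
Proof. by rewrite mulr_ge0 ?pij_ge0. Qed.

Lemma weight_le i j : a i j * pij e p i j <= affinity_sum.
Proof.
apply: le_trans (affinity_le i j); rewrite ler_piMr //; exact: pij_le1.
Qed.

Lemma pij_sym i j : pij e p i j = pij e p j i.
Proof.
by rewrite /pij e_sym; case: ifP => // _; apply: eq_bigl => W; rewrite andbC.
Qed.

Lemma mean_gain_sym i j : mean_gain i j = mean_gain j i.
Proof.
case: M_reach => Ms _ _.
by rewrite /mean_gain a_sym pij_sym Ms (mulrC (rowsum M i)).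
Qed.

Lemma mean_gain_ge0 i j : 0 <= mean_gain i j.
Proof. by rewrite mulr_ge0 ?weight_ge0 ?divr_ge0 ?sqr_ge0 ?mulr_ge0 ?rowsum_ge0. Qed.

Lemma mean_gain_le i j : mean_gain i j <= a i j * pij e p i j.
Proof.
rewrite ler_piMr ?weight_ge0 //.
have Mj : M i j <= rowsum M j by case: M_reach => -> _ _; exact: reach_le_rowsum.
have := mulr_ge0 (rowsum_ge0 i) (rowsum_ge0 j); rewrite le_eqVlt => /orP[/eqP <-|r0].
  by rewrite invr0 mulr0.
rewrite ler_pdivrMr // mul1r expr2 ler_pM ?reach_ge0 //; exact: reach_le_rowsum.
Qed.

(** * Homogeneity and drift of the payoff *)

Lemma total_gt0 i j : e i j -> 0 < Defs.total M.
Proof.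
move=> eij; apply: (lt_le_trans (rowsum_gt0 eij)).
by rewrite /Defs.total (bigD1 i) //= lerDl sumr_ge0 // => k _; exact: rowsum_ge0.
Qed.

Lemma payoff_normalize : Defs.total M != 0 ->
  payoff e a p (normalize M) = \sum_i \sum_j mean_gain i j.
Proof.
move=> T0; have rowE i : rowsum (normalize M) i = rowsum M i / Defs.total M.
  by rewrite /rowsum mulr_suml.
have T_gt0 : 0 < Defs.total M.
  by rewrite lt_neqAle eq_sym T0 sumr_ge0 // => i _; exact: rowsum_ge0.
apply: eq_bigr => i _; rewrite big_mkcond /=; apply: eq_bigr => j _.
rewrite !rowE /mean_gain /normalize; case: ifPn => [_|].
  have [z|nz] := eqVneq (rowsum M i * rowsum M j) 0.
    by rewrite z (mulrACA (rowsum M i)) z mul0r !invr0 !mulr0.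
  move: nz; rewrite mulf_eq0 negb_or => /andP[ri rj].
  by congr (_ * _); field; rewrite T0 ri rj.
by rewrite pmulr_lgt0 ?invr_gt0 // -leNgt => Mle;
  rewrite (_ : M i j = 0) ?expr0n ?mul0r ?mulr0 //; apply/eqP; rewrite eq_le Mle reach_ge0.
Qed.

(** Half the gradient of the payoff along symmetric increments: symmetry merges the contributions of
    the two row sums into one. *)
Definition slope i j :=
  a i j * pij e p i j * (M i j / (rowsum M i * rowsum M j))
    - rowsum mean_gain i / rowsum M i.

(* Up to a factor [2], the expected first-order variation of the payoff: a sum of
   variances of [j |-> a_ij p_ij M_ij / (M_i M_j)] under the weights [M_ij]. *)
Lemma drift_ge0 : 0 <= \sum_i \sum_j mean_gain i j * slope i j.
Proof.
apply: sumr_ge0 => i _; set m := rowsum mean_gain i / rowsum M i.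
pose y j := a i j * pij e p i j * (M i j / (rowsum M i * rowsum M j)).
have mgE j : mean_gain i j = M i j * y j by rewrite /mean_gain /y; ring.
have key : \sum_j M i j * (y j - m) ^+ 2 = \sum_j mean_gain i j * slope i j.
  (* The correction vanishes because [m] is the mean of [y] under the weights [M i j]; for a zero
     row sum, [m] is 0. *)
  have -> : \sum_j M i j * (y j - m) ^+ 2 =
      \sum_j mean_gain i j * slope i j - m * (rowsum mean_gain i - m * rowsum M i).
    rewrite /rowsum mulrBr !mulr_sumr -!sumrB; apply: eq_bigr => j _.
    by rewrite /slope -/m -/(y j) mgE; ring.
  have [r0|r_neq0] := eqVneq (rowsum M i) 0.
    by rewrite /m r0 invr0 mulr0 mul0r subr0.
  by rewrite /m divfK // subrr mulr0 subr0.
rewrite -key; apply: sumr_ge0 => j _; rewrite mulr_ge0 ?sqr_ge0 //; exact: reach_ge0.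
Qed.

Lemma expected_slope_ge0 :
  0 <= \sum_(o : outcome V) trans_prob p M o * \sum_i \sum_j gain M o i j * slope i j.
Proof.
suff -> : \sum_(o : outcome V) trans_prob p M o * (\sum_i \sum_j gain M o i j * slope i j) =
    \sum_i \sum_j mean_gain i j * slope i j by exact: drift_ge0.
under eq_bigr do rewrite mulr_sumr.
rewrite exchange_big; apply: eq_bigr => i _.
under eq_bigr do rewrite mulr_sumr.
rewrite exchange_big; apply: eq_bigr => j _.
by rewrite -expected_gain mulr_suml; apply: eq_bigr => o _; rewrite mulrA.
Qed.

(** * One-step lower bound with its remainder absorbed *)

Lemma rowsum_step o i : rowsum (step e a M o) i = rowsum M i + rowsum (gain M o) i.
Proof. by rewrite /rowsum -big_split; apply: eq_bigr => j _; rewrite /= stepE. Qed.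

Lemma rowsum_gain_ge0 o i : 0 <= rowsum (gain M o) i.
Proof. by apply: sumr_ge0 => j _; exact: gain_ge0. Qed.

Lemma rowsum_gain_le o i : rowsum (gain M o) i <= affinity_sum.
Proof.
by apply: le_trans (row_affinity_le i); apply: ler_sum => j _; exact: gain_le.
Qed.

Lemma rowsum_gain0 o i : rowsum M i = 0 -> rowsum (gain M o) i = 0.
Proof.
move=> r0; apply: big1 => j _; apply: gain_nonedge; apply/negP => /rowsum_gt0.
by rewrite r0 ltxx.
Qed.

(** For a row sum [r > 0] with increment [s], [1 / r - 1 / (r + s) = s / (r * (r + s))], and
    [(r + s) / r] is at most the constant in front. *)
Lemma inv_rowsum_drop o i :
  rowsum (gain M o) i * (rowsum M i)^-1 ^+ 2 <=
  (1 + affinity_sum * inv_rowsum_sum v0) *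
    ((rowsum M i)^-1 - (rowsum (step e a M o) i)^-1).
Proof.
rewrite rowsum_step; set r := rowsum M i; set s := rowsum (gain M o) i.
have := rowsum_ge0 i; rewrite le_eqVlt -/r => /orP[/eqP r0|r_gt0].
  by rewrite /s rowsum_gain0 // -r0 addr0 mul0r subrr mulr0.
have s0 : 0 <= s by exact: rowsum_gain_ge0.
have rs_gt0 : 0 < r + s by rewrite ltr_pwDl.
have -> : r^-1 - (r + s)^-1 = s * (r^-1 * (r + s)^-1).
  by field; rewrite !gt_eqF.
rewrite [leRHS]mulrCA ler_wpM2l // [leRHS]mulrCA expr2 ler_wpM2l ?invr_ge0 ?(ltW r_gt0) //.
rewrite ler_pdivlMr //.
have -> : r^-1 * (r + s) = 1 + s * r^-1 by field; rewrite gt_eqF.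
rewrite lerD2l ler_pM ?invr_ge0 ?(ltW r_gt0) //.
  exact: rowsum_gain_le.
exact: inv_rowsum_le_sum.
Qed.

Lemma inv_rowsum_sum_step o : inv_rowsum_sum (step e a M o) <= inv_rowsum_sum M.
Proof.
apply: ler_sum => i _; rewrite -subr_ge0.
have c_gt0 : 0 < 1 + affinity_sum * inv_rowsum_sum v0.
  by rewrite ltr_pwDl // mulr_ge0 ?affinity_sum_ge0 ?inv_rowsum_v0_ge0.
rewrite -(pmulr_rge0 _ c_gt0); apply: le_trans (inv_rowsum_drop o i).
by rewrite mulr_ge0 ?rowsum_gain_ge0 ?sqr_ge0.
Qed.

(** Summing [payoff_term_lower] over ordered pairs gives a first-order part, [2] times the sum
    against [slope], and an error that [inv_rowsum_drop] turns into the decrease of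
    [inv_rowsum_sum]. *)
Lemma sum_mean_gain_step o :
  \sum_i \sum_j mean_gain i j + 2 * (\sum_i \sum_j gain M o i j * slope i j)
    - penalty * (inv_rowsum_sum M - inv_rowsum_sum (step e a M o)) <=
  \sum_i \sum_j a i j * pij e p i j * (step e a M o i j ^+ 2 /
     (rowsum (step e a M o) i * rowsum (step e a M o) j)).
Proof.
pose D := gain M o; pose r := rowsum M; pose s := rowsum D.
pose y i j := a i j * pij e p i j * (M i j / (r i * r j)).
have term i j : mean_gain i j + 2 * (y i j * D i j)
     - mean_gain i j * (s i / r i) - mean_gain i j * (s j / r j)
     - affinity_sum * remainder_const * (D i j * (r i)^-1 ^+ 2)
     - affinity_sum * remainder_const * (D i j * (r j)^-1 ^+ 2) <=
   a i j * pij e p i j * (step e a M o i j ^+ 2 /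
     (rowsum (step e a M o) i * rowsum (step e a M o) j)).
  have [eij|neij] := boolP (e i j); last first.
    rewrite /y /mean_gain /D gain_nonedge // /pij (negbTE neij).
    by rewrite !(mulr0, mul0r) !subr0 addr0.
  have ri : 0 < r i by exact: rowsum_gt0 eij.
  have rj : 0 < r j by apply: (@rowsum_gt0 j i); rewrite e_sym.
  have Mj : M i j <= r j by case: M_reach => -> _ _; exact: reach_le_rowsum.
  have D_bnd : 0 <= D i j <= affinity_sum.
    by rewrite gain_ge0 (le_trans (gain_le _ _ _ _)) // affinity_le.
  have s_bnd k : 0 <= s k <= affinity_sum by rewrite rowsum_gain_ge0 rowsum_gain_le.
  have := payoff_term_lower ri rj (reach_ge0 i j) (reach_le_rowsum i j) Mj
    D_bnd (s_bnd i) (s_bnd j) (inv_rowsum_le_sum i) (inv_rowsum_le_sum j).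
  move=> /(ler_wpM2l (weight_ge0 i j)); rewrite !rowsum_step stepE -/r -/s -/D.
  apply: le_trans.
  have Q_ge0 : 0 <= remainder_const * (D i j * ((r i)^-1 ^+ 2 + (r j)^-1 ^+ 2)).
    by rewrite !mulr_ge0 ?remainder_const_ge0 ?gain_ge0 ?addr_ge0 ?sqr_ge0.
  have := ler_wpM2r Q_ge0 (weight_le i j).
  rewrite -/remainder_const /y /mean_gain -/r; set b := a i j * _; lra.
apply: le_trans (ler_sum _ (fun i _ => ler_sum _ (fun j _ => term i j))).
under [leRHS]eq_bigr do rewrite !sumrB big_split /=.
rewrite 4![in leRHS]sumrB [in leRHS]big_split /=.
(* By symmetry, terms attached to [j] equal those attached to [i]; this produces the factor 2 in the
   first-order part and in [penalty]. *)
have sum_sym (f : V -> V -> R) (k : V -> R) : (forall i j, f i j = f j i) ->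
    \sum_i \sum_j f i j * k j = \sum_i \sum_j f i j * k i.
  by move=> fs; rewrite exchange_big; apply: eq_bigr => i _; apply: eq_bigr => j _; rewrite fs.
have -> : \sum_i \sum_j mean_gain i j * (s j / r j) = \sum_i \sum_j mean_gain i j * (s i / r i).
  by apply: (sum_sym _ (fun j => s j / r j)); exact: mean_gain_sym.
have sumZ c (f : V -> V -> R) : \sum_i \sum_j c * f i j = c * \sum_i \sum_j f i j.
  by rewrite mulr_sumr; apply: eq_bigr => i _; rewrite mulr_sumr.
rewrite !sumZ.
have -> : \sum_i \sum_j D i j * (r j)^-1 ^+ 2 = \sum_i \sum_j D i j * (r i)^-1 ^+ 2.
  by apply: (sum_sym _ (fun j => (r j)^-1 ^+ 2)); exact: gain_sym.
have S2 : \sum_i \sum_j mean_gain i j * (s i / r i) =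
    \sum_i \sum_j D i j * (rowsum mean_gain i / r i).
  by apply: eq_bigr => i _; rewrite -!mulr_suml /s /rowsum; ring.
have S1 : \sum_i \sum_j gain M o i j * slope i j =
    \sum_i \sum_j y i j * D i j - \sum_i \sum_j D i j * (rowsum mean_gain i / r i).
  rewrite -sumrB; apply: eq_bigr => i _; rewrite -sumrB; apply: eq_bigr => j _.
  by rewrite /slope -/r -/(y i j) -/D; ring.
have S3 : \sum_i \sum_j D i j * (r i)^-1 ^+ 2 <=
    (1 + affinity_sum * inv_rowsum_sum v0) * (inv_rowsum_sum M - inv_rowsum_sum (step e a M o)).
  rewrite -sumrB mulr_sumr; apply: ler_sum => i _; rewrite -mulr_suml.
  exact: inv_rowsum_drop.
have AC_ge0 : 0 <= affinity_sum * remainder_const.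
  by rewrite mulr_ge0 ?affinity_sum_ge0 ?remainder_const_ge0.
have := ler_wpM2l AC_ge0 S3.
rewrite S1 S2 /penalty; lra.
Qed.
End Reachable.

(** The constant shift makes the process nonnegative, as the convergence theorem for values in
    [[0, B]] requires. *)
Definition compensated h :=
  \sum_i \sum_j mean_gain (state e a v0 h) i j
  - penalty * inv_rowsum_sum (state e a v0 h) + penalty * inv_rowsum_sum v0.

Lemma inv_rowsum_sum_ge0 M : reachable M -> 0 <= inv_rowsum_sum M.
Proof. by move=> Mr; apply: sumr_ge0 => i _; rewrite invr_ge0 (rowsum_ge0 Mr). Qed.

Lemma compensated_ge0 h : 0 <= compensated h.
Proof.
have Mr := reachable_state h.
rewrite /compensated -addrA addr_ge0 //.
  by apply: sumr_ge0 => i _; apply: sumr_ge0 => j _; exact: mean_gain_ge0.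
rewrite addrC subr_ge0 ler_wpM2l ?penalty_ge0 //.
by apply: ler_sum => i _; exact: inv_rowsum_le.
Qed.

Lemma compensated_le h :
  compensated h <= \sum_i \sum_j a i j * pij e p i j + penalty * inv_rowsum_sum v0.
Proof.
have Mr := reachable_state h; rewrite lerD2r.
rewrite lerBlDr ler_wpDr ?(mulr_ge0 penalty_ge0 (inv_rowsum_sum_ge0 Mr)) //.
by apply: ler_sum => i _; apply: ler_sum => j _; exact: mean_gain_le.
Qed.

Lemma compensated_submartingale h :
  compensated h <=
  \sum_(o : outcome V) trans_prob p (state e a v0 h) o * compensated (rcons h o).
Proof.
have Mr := reachable_state h; set M := state e a v0 h in Mr *.
pose L o := \sum_i \sum_j gain M o i j * slope M i j.
have step_le o : compensated h + 2 * L o <= compensated (rcons h o).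
  have := sum_mean_gain_step Mr o; rewrite /compensated state_rcons -/M -/(L o).
  rewrite /mean_gain; lra.
apply: (@le_trans _ _ (\sum_(o : outcome V) trans_prob p M o * (compensated h + 2 * L o))).
  under eq_bigr do rewrite mulrDr mulrCA.
  rewrite big_split /= -mulr_suml -mulr_sumr trans_prob_sum1 // mul1r lerDl.
  by rewrite mulr_ge0 // expected_slope_ge0.
by apply: ler_sum => o _; rewrite ler_wpM2l // trans_prob_ge0.
Qed.
End Model.

(** * Almost sure convergence of the payoff *)

Unset Implicit Arguments.

Theorem theorem1 (R : realType) (V : finType) (e : rel V)
  (e_sym : symmetric e) (e_irr : irreflexive e)
  (a : V -> V -> R)
  (a_ge0 : forall i j, 0 <= a i j) (a_sym : forall i j, a i j = a j i)
  (a_edge : forall i j, 0 < a i j -> e i j)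
  (p : {set V} -> R) (p_ge0 : forall W, 0 <= p W)
  (p_sum1 : \sum_(W : {set V}) p W = 1)
  (ap_pos : exists i j, 0 < a i j * pij e p i j)
  (v0 : V -> V -> R) (v0_sym : forall i j, v0 i j = v0 j i)
  (v0_ge0 : forall i j, 0 <= v0 i j)
  (v0_edge : forall i j, 0 < v0 i j <-> e i j)
  (d : measure_display) (T : measurableType d) (P : probability T R)
  (X : nat -> T -> outcome V)
  (X_meas : forall n o, measurable [set w | X n w = o])
  (X_law : forall (h : seq (outcome V)) (o : outcome V),
      P (hist_ev X (rcons h o)) =
      (P (hist_ev X h) * (trans_prob p (state e a v0 h) o)%:E)%E) :
  {ae P, forall w : T,
     cvgn (fun n : nat =>
       payoff e a p
         (normalize (state e a v0 [seq X k w | k <- iota 0 n])))}.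
Proof.
pose law h := trans_prob p (state e a v0 h).
have reach h : reachable e v0 (state e a v0 h) by exact: reachable_state.
have law_ge0 h o : 0 <= law h o by exact: (trans_prob_ge0 p_ge0 v0_ge0 (reach h)).
have law_sum1 h : \sum_o law h o = 1 by exact: (trans_prob_sum1 p_sum1).
(* [hist_ev X h] and the cylinder of [h] unfold to the same set, so [X_law] applies as it stands. *)
have := bounded_submartingale_cvg X_meas law_ge0 law_sum1 X_law
  (compensated_ge0 e_sym a_ge0 a_sym p_ge0 v0_sym v0_ge0 v0_edge)
  (compensated_le e_sym a_ge0 a_sym p_ge0 v0_sym v0_ge0 v0_edge)
  (compensated_submartingale e_sym e_irr a_ge0 a_sym p_ge0 p_sum1 v0_sym v0_ge0 v0_edge).
apply: filterS => w g_cvg.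
pose Phi n := inv_rowsum_sum (state e a v0 (past X n w)).
have Phi_cvg : cvgn Phi.
  apply: nonincreasing_is_cvgn.
    apply/nonincreasing_seqP => n; rewrite /Phi pastS state_rcons.
    exact: (inv_rowsum_sum_step a_ge0 v0_ge0 v0_edge (reach _)).
  by exists 0 => _ [n _ <-]; exact: (inv_rowsum_sum_ge0 v0_ge0 (reach _)).
(* A positive [a i j * pij e p i j] yields an edge, so the total weight is nonzero and normalization
   leaves the payoff unchanged. *)
have [i0 [j0 ap0]] := ap_pos.
have e0 : e i0 j0.
  by apply/negPn/negP => /negbTE ne; move: ap0; rewrite /pij ne mulr0 ltxx.
have payoffE n : payoff e a p (normalize (state e a v0 [seq X k w | k <- iota 0 n])) =
    compensated e a p v0 (past X n w) + penalty a v0 * Phi n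
      + - (penalty a v0 * inv_rowsum_sum v0).
  rewrite (payoff_normalize _ _ v0_ge0 (reach _)); last first.
    by rewrite gt_eqF // (total_gt0 v0_ge0 v0_edge (reach _) e0).
  by rewrite /compensated /Phi -/(past X n w); ring.
under eq_fun do rewrite payoffE.
apply: is_cvgD; last exact: is_cvg_cst.
by apply: is_cvgD => //; apply: is_cvgMr.
Qed.
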